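(* For every real $0\leq\alpha\leq 1$ there exists an immeasurable subset of $\mathbb{R}$ of Hausdorff dimension $\alpha$. Moreover, these sets can be chosen to be additive subgroups of $\mathbb{R}$.
   Context: A Borel measure on $\mathbb{R}$ is a (countably additive, $[0,\infty]$-valued) measure $\mu$ defined on a $\sigma$-algebra $\mathcal{S}$ of subsets of $\mathbb{R}$ containing all Borel sets ($\mathcal S$ may be larger than the Borel $\sigma$-algebra, and $\mu$ is not assumed to be $\sigma$-finite on $\mathbb{R}$). It is translation invariant if $S+t\in\mathcal{S}$ and $\mu(S+t)=\mu(S)$ for all $S\in\mathcal{S}$, $t\in\mathbb{R}$. A Borel set $B$ is $\sigma$-finite for $\mu$ if it is a countable union of sets in $\mathcal{S}$ of finite $\mu$-measure. A nonempty Borel set $B\subset\mathbb{R}$ is called immeasurable if for every translation invariant Borel measure $\mu$ on $\mathbb{R}$, either $\mu(B)=0$ or $B$ is not $\sigma$-finite for $\mu$. *)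

(* Defs.v *)
From HB Require Import structures.
From mathcomp Require Import all_boot all_order all_algebra.
From mathcomp Require Import all_classical all_reals all_analysis.
Set Implicit Arguments.
Unset Strict Implicit.
Unset Printing Implicit Defensive.
Import Order.TTheory GRing.Theory Num.Theory.
Import numFieldNormedType.Exports.
Local Open Scope classical_set_scope.
Local Open Scope ring_scope.

Definition borel (R : realType) : set (set R) :=
  @measurable _ (measurableTypeR R).

Definition translate (R : realType) (t : R) (A : set R) : set R :=
  [set x + t | x in A].

Definition translation_invariant (R : realType) (S : set (set R))
    (mu : set R -> \bar R) : Prop :=
  forall (A : set R) (t : R), S A ->
    S (translate t A) /\ mu (translate t A) = mu A.

(* The measurable sets of [g_sigma_algebraType S] are those of [<<s S >>],
   which is [S] itself because [S] is assumed to be a sigma-algebra.  Values of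
   [mu] outside [S] are never used. *)
Definition immeasurable (R : realType) (B : set R) : Prop :=
  [/\ borel B, B !=set0 &
      forall (S : set (set R))
        (mu : {measure set (g_sigma_algebraType S) -> \bar R}),
        sigma_algebra setT S -> @borel R `<=` S ->
        translation_invariant S mu ->
        mu B = 0%E \/ ~ @sigma_finite _ (g_sigma_algebraType S) R B mu].

(* [diam set0 = -oo], a supremum over the empty set. *)
Definition diam (R : realType) (U : set R) : \bar R :=
  ereal_sup [set `|x - y|%:E | x in U & y in U].

(* [(diam U)^s], with the conventions that the empty set has gauge 0 for every
   [s], and a one-point set has gauge 1 for [s = 0]. *)
Definition hausdorff_gauge (R : realType) (s : R) (U : set R) : \bar R :=
  if U == set0 then 0%E else (diam U `^ s)%E.

Definition hausdorff_premeasure (R : realType) (s delta : R) (A : set R)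
    : \bar R :=
  ereal_inf [set (\sum_(0 <= n <oo) hausdorff_gauge s (U n))%E
            | U in [set U : (set R)^nat |
                A `<=` \bigcup_n U n /\
                forall n, (diam (U n) <= delta%:E)%E]].

Definition hausdorff_measure (R : realType) (s : R) (A : set R) : \bar R :=
  ereal_sup [set hausdorff_premeasure s delta A | delta in [set d : R | 0 < d]].

Definition hausdorff_dim (R : realType) (A : set R) : \bar R :=
  ereal_inf [set s%:E | s in [set s : R |
    0 <= s /\ hausdorff_measure s A = 0%E]].

(* Main.v *)
Require Import Defs.
From mathcomp Require Import finmap.
From mathcomp Require Import all_boot all_order all_algebra.
From mathcomp Require Import all_classical all_reals all_analysis.
From mathcomp Require Import ring lra zify.
Set Implicit Arguments.
Unset Strict Implicit.
Unset Printing Implicit Defensive.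
Import Order.TTheory GRing.Theory Num.Theory.
Import numFieldNormedType.Exports.
Local Open Scope classical_set_scope.
Local Open Scope ring_scope.

(* The group is G = {x : 2^(m_k) dist(x, 2^(-n_k) Z) -> 0} for rapidly growing
   scales n_k <= m_k with n_k / m_k -> alpha.

   Immeasurability.  G is a countable intersection of increasing countable
   unions of sets tail_near n m.  If mu is sigma-finite and nonzero on G,
   continuity from above yields thresholds t such that the set
   K = {x : forall n, forall k >= t n, 2^(m_k) dist(x, 2^(-n_k) Z) <= 2^(-n)}
   has positive measure.  Sums of 2^(-m_k - i - 1) over subsets of a sparse
   sequence of pairs (k, i) with k >= t (i + 3) form an uncountable subset of G
   whose differences avoid K - K, so G contains uncountably many disjoint
   translates of K, all of the same positive measure: impossible.

   Dimension.  The covers of G by the 2^(-m_k)-neighbourhoods of 2^(-n_k) Z give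
   the upper bound.  For the lower bound, insert into the binary expansion of
   y in [0, 1) blocks of zeros at the positions n_k, ..., m_k + k - 1; the
   result lies in G, and the inverse of this map is Hoelder of every exponent
   s < alpha, so a cover of G pulls back to a cover of [0, 1). *)

(** * Dyadic expansions and the digit-spreading map *)

Section BinaryExpansions.
Variable R : realType.
Implicit Types (b : nat -> bool) (i k m n N M : nat) (x y z : R).

Definition dyad n : R := 2^-1 ^+ n.

Lemma dyad_gt0 n : 0 < dyad n.
Proof. by rewrite exprn_gt0 // invr_gt0. Qed.

Lemma dyad0 : dyad 0 = 1. Proof. exact: expr0. Qed.

Lemma dyadS n : dyad n = 2 * dyad n.+1.
Proof. by rewrite /dyad exprS mulrA divff ?mul1r. Qed.

Lemma dyadE n : dyad n = (2 ^+ n)^-1.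
Proof. exact: exprVn. Qed.

Lemma dyad_le m n : (m <= n)%N -> dyad n <= dyad m.
Proof. by move=> mn; apply: ler_wiXn2l => //; lra. Qed.

Lemma dyad_lt_eps (e : R) : 0 < e -> exists n, dyad n < e.
Proof.
move=> e0; exists (Num.truncn e^-1).+1; rewrite dyadE -[ltRHS]invrK.
rewrite ltf_pV2 ?posrE ?exprn_gt0 ?invr_gt0 //.
apply: lt_trans (truncnS_gt _) _.
by rewrite -natrX ltr_nat ltn_expl.
Qed.

Definition digit_sum b N : R := \sum_(i < N) (b i)%:R * dyad i.+1.

Definition binval b : R := limn (digit_sum b).

Lemma digit_sumS b N :
  digit_sum b N.+1 = digit_sum b N + (b N)%:R * dyad N.+1.
Proof. by rewrite /digit_sum big_ord_recr. Qed.

(** A further digit uses at most half of the remaining room, so [digit_sum b N + dyad R N] never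
    increases with [N]. *)
Lemma digit_sum_bounds b N M : (N <= M)%N ->
  digit_sum b N <= digit_sum b M <= digit_sum b N + dyad N - dyad M.
Proof.
move=> /subnKC <-; elim: (M - N)%N => [|k IH]; first by rewrite addn0; lra.
rewrite addnS digit_sumS; have := dyad_gt0 (N + k).+1.
by have := dyadS (N + k); case: (b _) => /=; lra.
Qed.

Lemma digit_sum_cvg b : cvgn (digit_sum b).
Proof.
apply: nondecreasing_is_cvgn.
  by move=> N M /(digit_sum_bounds b)/andP[].
exists 1 => _ [N _ <-]; have := digit_sum_bounds b (leq0n N).
by rewrite [digit_sum _ 0]big_ord0 dyad0; have := dyad_gt0 N; lra.
Qed.

Lemma binval_bounds b N :
  digit_sum b N <= binval b <= digit_sum b N + dyad N.
Proof.
apply/andP; split.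
  apply: limr_ge; first exact: digit_sum_cvg.
  by exists N => // M /= /(digit_sum_bounds b)/andP[].
apply: limr_le; first exact: digit_sum_cvg.
exists N => // M /= /(digit_sum_bounds b).
by have := dyad_gt0 M; lra.
Qed.

Lemma digit_sum_const b N M : (N <= M)%N ->
  (forall q, (N <= q < M)%N -> ~~ b q) -> digit_sum b M = digit_sum b N.
Proof.
move=> /subnKC <-; elim: (M - N)%N => [|k IH] bF; first by rewrite addn0.
rewrite addnS digit_sumS (negbTE (bF _ _)) ?mul0r ?addr0; last by lia.
by apply: IH => q qk; apply: bF; lia.
Qed.

Lemma digit_sum_natmul b N : exists z : nat, digit_sum b N = z%:R * dyad N.
Proof.
elim: N => [|N [z IH]]; first by exists 0; rewrite [LHS]big_ord0 mul0r.
exists (2 * z + b N)%N.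
by rewrite digit_sumS IH dyadS natrD natrM; ring.
Qed.

Definition bit y i : bool := odd (Num.truncn (2 ^+ i.+1 * y)).

Lemma truncn_double x : 0 <= x -> (Num.truncn (2 * x))./2 = Num.truncn x.
Proof.
move=> x0; apply/esym/eqP; rewrite truncn_eq //.
have /andP[] : (Num.truncn (2 * x))%:R <= 2 * x < (Num.truncn (2 * x)).+1%:R.
  by apply: truncn_itv; lra.
set t := Num.truncn _ => t1 t2.
have := odd_double_half t; rewrite -addnn => te.
apply/andP; split.
  have : (t./2 + t./2)%:R <= t%:R :> R by rewrite ler_nat; lia.
  by rewrite natrD; lra.
have : t.+1%:R <= (t./2.+1 + t./2.+1)%:R :> R.
  by rewrite ler_nat; case: (odd t) te => /=; lia.
by rewrite natrD; lra.
Qed.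

Definition rank (F : nat -> bool) N : nat := \sum_(i < N) F i.

(** Since [rank F i] marked positions precede [i], the digits of [y] fill the marked positions in
    order. *)
Definition spread (F : nat -> bool) y : nat -> bool :=
  fun i => F i && bit y (rank F i).

Lemma rankS (F : nat -> bool) N : rank F N.+1 = (rank F N + F N)%N.
Proof. by rewrite /rank big_ord_recr. Qed.

Lemma rank_mono (F : nat -> bool) N M : (N <= M)%N -> (rank F N <= rank F M)%N.
Proof.
move=> /subnKC <-; elim: (M - N)%N => [|k IH]; first by rewrite addn0.
by rewrite addnS rankS; lia.
Qed.

Lemma rank_full (F : nat -> bool) N M :
  (N <= M)%N -> (forall q, (N <= q < M)%N -> F q) ->
  rank F M = (rank F N + (M - N))%N.
Proof.
move=> /subnKC; move: (M - N)%N => k <-.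
elim: k => [|k IH] HF; first by rewrite !addn0.
rewrite addnS rankS IH => [|q qk]; last by apply: HF; lia.
by rewrite (_ : F (N + k)%N) ?HF; lia.
Qed.

(** [t x] reads the integer part of [x] and its first [rank F N] binary digits as one integer, so
    spreading preserves the order of prefixes. The strict and the weak claim support each other in
    the induction; [y' < 1] makes the strict one vacuous at [N = 0]. *)
Lemma digit_sum_spread F y y' N : 0 <= y -> 0 <= y' < 1 ->
  let t (x : R) := Num.truncn (2 ^+ rank F N * x) in
  ((t y <= t y')%N -> digit_sum (spread F y) N <= digit_sum (spread F y') N) /\
  ((t y < t y')%N ->
     digit_sum (spread F y) N + dyad N <= digit_sum (spread F y') N).
Proof.
move=> y0 /andP[y'0 y'1] /=; elim: N => [|N].
  rewrite /rank big_ord0 expr0 !mul1r /digit_sum !big_ord0; split => // yy'.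
  by move: yy'; rewrite (truncn_def (n := 0) (x := y')) // y'0.
rewrite !digit_sumS rankS /spread; have dN := dyadS N; have := dyad_gt0 N.+1.
case: (F N) => /=; last first.
  rewrite addn0 => d0 [IH1 IH2].
  by split=> tt'; [have := IH1 tt' | have := IH2 tt']; lra.
rewrite addn1 /bit => d0.
(* Forgetting the last digit halves the prefix; the parity that is lost is the digit placed at
   position [N]. *)
have half x : 0 <= x -> Num.truncn (2 ^+ rank F N * x) =
    (Num.truncn (2 ^+ (rank F N).+1 * x))./2.
  by move=> x0; rewrite exprS -mulrA truncn_double // mulr_ge0 // exprn_ge0.
rewrite !half //.
move: (Num.truncn (2 ^+ (rank F N).+1 * y)) => t.
move: (Num.truncn (2 ^+ (rank F N).+1 * y')) => t'.
have := odd_double_half t; have := odd_double_half t'; rewrite -!addnn => e' e.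
set s := digit_sum _ _; set s' := digit_sum _ _ => -[IH1 IH2].
split=> tt'.
  have [lt|le] := ltnP t./2 t'./2.
    by have := IH2 lt; case: (odd t); case: (odd t') => /=; lra.
  have eqh : t./2 = t'./2 by lia.
  have : s <= s' by apply: IH1; lia.
  by case: (odd t) e; case: (odd t') e' => /= ? ?; try lia; lra.
have [lt|le] := ltnP t./2 t'./2.
  by have := IH2 lt; case: (odd t); case: (odd t') => /=; lra.
have eqh : t./2 = t'./2 by lia.
have : s <= s' by apply: IH1; lia.
by case: (odd t) e; case: (odd t') e' => /= ? ?; try lia; lra.
Qed.
End BinaryExpansions.

(** * Hoelder estimate for the inverse of the spreading map *)

Section InverseHolder.
Variable R : realType.
Implicit Types (x y : R).

(** The prefixes of [y], [y + dyad R (rank F N)] and [y'] strictly increase, so the digit sums are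
    two steps of [dyad R N] apart; one step pays for the digits of [spread F y] beyond [N]. *)
Lemma spread_gap (F : nat -> bool) y y' N : 0 <= y -> y' < 1 ->
  y + 2 * dyad R (rank F N) < y' ->
  binval R (spread F y) + dyad R N <= binval R (spread F y').
Proof.
move=> y0 y'1; set r := rank F N => yy'.
have d0 := dyad_gt0 R r; set y2 := y + dyad R r.
have dr : 2 ^+ r * dyad R r = 1.
  by rewrite dyadE divff // expf_neq0.
have p0 : 0 < 2 ^+ r :> R by rewrite exprn_gt0.
have ty2 : (Num.truncn (2 ^+ r * y) < Num.truncn (2 ^+ r * y2)%R)%N.
  rewrite truncn_gt_nat mulrDr dr -natr1.
  have /andP[] : (Num.truncn (2 ^+ r * y))%:R <= 2 ^+ r * y <
    (Num.truncn (2 ^+ r * y)).+1%:R by rewrite truncn_itv // mulr_ge0 // ltW.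
  by lra.
have ty' : (Num.truncn (2 ^+ r * y2)%R < Num.truncn (2 ^+ r * y')%R)%N.
  have /andP[h _] : (Num.truncn (2 ^+ r * y2))%:R <= 2 ^+ r * y2 <
    (Num.truncn (2 ^+ r * y2)).+1%:R.
    by rewrite truncn_itv // mulr_ge0 // ?ltW // /y2; lra.
  rewrite truncn_gt_nat -natr1.
  have : 2 ^+ r * (y2 + dyad R r) < 2 ^+ r * y' by rewrite ltr_pM2l // /y2; lra.
  by rewrite mulrDr dr; lra.
have y20 : 0 <= y2 by rewrite /y2; lra.
have y21 : 0 <= y2 < 1 by rewrite y20 /y2 /=; lra.
have y'01 : 0 <= y' < 1 by apply/andP; split; lra.
have [_ /(_ ty2) h1] := digit_sum_spread F N y0 y21.
have [_ /(_ ty') h2] := digit_sum_spread F N y20 y'01.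
have /andP[_ h3] := binval_bounds R (spread F y) N.
have /andP[h4 _] := binval_bounds R (spread F y') N.
by lra.
Qed.

Lemma dyad_powR n : dyad R n = 2 `^ (- n%:R).
Proof. by rewrite powRN powR_mulrn // dyadE. Qed.

(* The positions of the binary digits give the exponent: a prefix of [N]
   digits of [binval (spread F y)] carries [rank F N >= s * N - c] digits of
   [y]. *)
Lemma spread_inverse_holder (F : nat -> bool) (s c : R) y y' :
  0 <= s -> (forall N, s * N%:R <= (rank F N)%:R + c) ->
  (forall r, exists N, (r <= rank F N)%N) ->
  0 <= y -> y' < 1 -> y < y' ->
  y' - y <= 2 * 2 `^ (c + s) *
    `|binval R (spread F y') - binval R (spread F y)| `^ s.
Proof.
move=> s0 Hc Hr y0 y'1 yy'.
have [N0 HN0] : exists N, 2 * dyad R (rank F N) < y' - y.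
  have [|n hn] := @dyad_lt_eps R ((y' - y) / 2); first by lra.
  have [N /(dyad_le R) HN] := Hr n.
  by exists N; lra.
have [N HN minN] := ex_minnP (ex_intro
  (fun N => 2 * dyad R (rank F N) < y' - y) N0 HN0).
case: N HN minN => [|N HN minN].
  by rewrite /rank big_ord0 dyad0; lra.
have {minN} HN' : y' - y <= 2 * dyad R (rank F N).
  by rewrite leNgt; apply/negP => /minN; rewrite ltnn.
have gap : dyad R N.+1 <=
    `|binval R (spread F y') - binval R (spread F y)|.
  have : binval R (spread F y) + dyad R N.+1 <= binval R (spread F y').
    by apply: spread_gap => //; lra.
  by move=> ?; apply: le_trans (ler_norm _); lra.
apply: le_trans HN' _; rewrite -mulrA ler_pM2l //.
have /(@ge0_ler_powR R s s0) := gap; rewrite !nnegrE => /(_ _ _) h.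
apply: (@le_trans _ _ (2 `^ (c + s) * dyad R N.+1 `^ s)); last first.
  by rewrite ler_wpM2l ?powR_ge0 // h // ltW // dyad_gt0.
rewrite !dyad_powR -powRrM -powRD; last by rewrite (_ : 2 != 0 :> R) ?implybT.
rewrite ler_powR //; first by lra.
by have := Hc N; rewrite -natr1; lra.
Qed.

End InverseHolder.

(** * Factorial growth of the scales *)

Section Scales.
Variables (R : realType) (alpha : R).
Implicit Types (k n m N : nat).

(* [precision k] is m_k and [mesh k] is n_k.  Since [mesh_min k] is negligible
   before m_k and m_(k-1) is negligible before [mesh_min k], taking the maximum
   does not change lim n_k / m_k = alpha, but keeps the zero blocks disjoint even
   for [alpha = 0].  The locks prevent unification from computing factorials. *)
Definition precision k : nat := locked (k.*2.+2)`!.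
Definition mesh_min k : nat := locked (k.*2.+1)`!.
Definition mesh k : nat := maxn (Num.truncn (alpha * (precision k)%:R)) (mesh_min k).

Lemma precisionE k : precision k = (k.*2.+2 * mesh_min k)%N.
Proof. by rewrite /precision /mesh_min -!lock factS. Qed.

Lemma mesh_minS k : mesh_min k.+1 = (k.*2.+3 * precision k)%N.
Proof. by rewrite /mesh_min /precision -!lock doubleS factS. Qed.

Lemma mesh_min_gt k : (k < mesh_min k)%N.
Proof.
elim: k => [|k IH]; first by rewrite /mesh_min -lock.
rewrite mesh_minS precisionE.
by rewrite mulnA; apply: leq_trans (leq_mul (_ : 2 <= _)%N IH); lia.
Qed.

Lemma precision_gt k : (k < precision k)%N.
Proof. by rewrite precisionE; have := mesh_min_gt k; nia. Qed.

Lemma precision_lt_meshS k : (precision k + k < mesh k.+1)%N.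
Proof.
by rewrite leq_max mesh_minS; apply/orP; right; have := precision_gt k; nia.
Qed.

(** Consecutive precisions have ratio (2k + 3)(2k + 4). The slack [2 * k + 4] later pays for the
    padding zeros and for the factors other than [2 ^ mesh k] in the cover counts. *)
Lemma precision_growth (e : R) : 0 < e ->
  exists k0, forall k, (k0 <= k)%N ->
    (precision k + 2 * k + 4)%:R <= e * (precision k.+1)%:R.
Proof.
move=> e0; exists (Num.truncn (8 / e)) => k hk.
apply: le_trans (_ : (8 * precision k)%:R <= _).
  by rewrite ler_nat; have := precision_gt k; lia.
rewrite (precisionE k.+1) mesh_minS; move: (precision k) => M.
rewrite !natrM !mulrA ler_wpM2r //.
have hk' : 8 / e <= (k.+1)%:R.
  by apply/ltW/(lt_le_trans (truncnS_gt _)); rewrite ler_nat.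
have h8 : 8 <= e * (k.+1)%:R by rewrite mulrC -ler_pdivrMr.
apply: le_trans h8 _; rewrite -mulrA ler_wpM2l ?(ltW e0) // -natrM ler_nat.
by rewrite doubleS; nia.
Qed.

Hypothesis alpha01 : 0 <= alpha <= 1.

Lemma mesh_le_precision k : (mesh k <= precision k)%N.
Proof.
case/andP: alpha01 => a0 a1; rewrite geq_max; apply/andP; split.
  rewrite truncn_le_nat; apply: le_lt_trans (_ : (precision k)%:R < _).
    by rewrite ler_piMl.
  by rewrite ltr_nat.
by rewrite precisionE; lia.
Qed.

Lemma precision_lt_mesh k k' : (k < k')%N -> (precision k + k < mesh k')%N.
Proof.
elim: k' => // k' IH; rewrite ltnS leq_eqVlt => /predU1P[->|/IH].
  exact: precision_lt_meshS.
by have := mesh_le_precision k'; have := precision_lt_meshS k'; lia.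
Qed.

Lemma precision_lt k k' : (k < k')%N -> (precision k + k < precision k')%N.
Proof. by move=> /precision_lt_mesh; have := mesh_le_precision k'; lia. Qed.

Lemma mesh_ge k : alpha * (precision k)%:R <= (mesh k)%:R + 1.
Proof.
have := truncnS_gt (alpha * (precision k)%:R); rewrite -natr1 => h.
have : (Num.truncn (alpha * (precision k)%:R))%:R <= (mesh k)%:R :> R.
  by rewrite ler_nat leq_maxl.
by lra.
Qed.

(** In the maximum, the first term is at most [alpha] times the precision, and [mesh_min k] is the
    fraction 1 / (2k + 2) of it, eventually below [s > 0]. *)
Lemma mesh_le_eventually (s : R) : alpha < s ->
  exists k0, forall k, (k0 <= k)%N -> (mesh k)%:R <= s * (precision k)%:R.
Proof.
case/andP: alpha01 => a0 a1 sa; exists (Num.truncn s^-1) => k hk.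
rewrite /mesh natr_max; rewrite ge_max; apply/andP; split.
  apply: le_trans (_ : alpha * (precision k)%:R <= _).
    by have /andP[] := truncn_itv (mulr_ge0 a0 (ler0n R (precision k))).
  by rewrite ler_wpM2r // ltW.
rewrite precisionE natrM mulrA ler_peMl //.
have s0 : 0 < s by lra.
rewrite mulrC -ler_pdivrMr // div1r; apply/ltW.
apply: lt_le_trans (truncnS_gt _) _; rewrite ler_nat.
by apply: leq_ltn_trans hk _; lia.
Qed.

End Scales.

(** * The group, its cores and their disjoint translates *)

Section Group.
Variables (R : realType) (alpha : R).
Implicit Types (k n m N : nat) (x y : R).

Local Notation mesh := (mesh alpha).

Definition near_lattice k n : set R :=
  [set x | exists z : int, `|x - z%:~R * dyad R (mesh k)| <= dyad R (n + precision k)].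

Definition approx_group : set R :=
  [set x | forall n, exists m, forall k, (m <= k)%N -> near_lattice k n x].

Definition approx_core (t : nat -> nat) : set R :=
  [set x | forall n k, (t n <= k)%N -> near_lattice k n x].

Lemma near_latticeB k n x y :
  near_lattice k n.+1 x -> near_lattice k n.+1 y -> near_lattice k n (x - y).
Proof.
move=> [z xz] [z' yz']; exists (z - z').
rewrite (_ : _ - _ = (x - z%:~R * dyad R (mesh k)) - (y - z'%:~R * dyad R (mesh k))).
  rewrite (le_trans (ler_normB _ _)) // (dyadS _ (n + _)).
  by move: xz yz'; rewrite !addSn; lra.
by rewrite rmorphB /=; ring.
Qed.

Lemma near_lattice0 k n : near_lattice k n 0.
Proof. by exists 0; rewrite mul0r subr0 normr0 ltW // dyad_gt0. Qed.

Lemma approx_group_zmod_closed : zmod_closed [in approx_group].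
Proof.
split; first by apply/mem_set => n; exists 0 => k _; exact: near_lattice0.
move=> x y /set_mem Gx /set_mem Gy; apply/mem_set => n.
have [m hm] := Gx n.+1; have [m' hm'] := Gy n.+1.
exists (maxn m m') => k; rewrite geq_max => /andP[mk m'k].
by apply: near_latticeB; [exact: hm | exact: hm'].
Qed.

Lemma approx_groupB x y : approx_group x -> approx_group y -> approx_group (x - y).
Proof.
move=> Gx Gy; apply/set_mem.
by apply: approx_group_zmod_closed.2; exact/mem_set.
Qed.

Lemma approx_groupD x y : approx_group x -> approx_group y -> approx_group (x + y).
Proof.
move=> Gx Gy; rewrite -[y]opprK; apply: approx_groupB => //.
rewrite -[- y]add0r; apply: approx_groupB => //.
exact/set_mem/approx_group_zmod_closed.1.
Qed.

Lemma approx_core_sub t : approx_core t `<=` approx_group.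
Proof. by move=> x Kx n; exists (t n) => k; exact: Kx. Qed.

Lemma borel_near_lattice k n : borel (near_lattice k n).
Proof.
rewrite (_ : near_lattice k n = \bigcup_(z : int)
  `[z%:~R * dyad R (mesh k) - dyad R (n + precision k),
    z%:~R * dyad R (mesh k) + dyad R (n + precision k)]%classic).
  apply: countable_bigcupT_measurable; first exact: countableP.
  by move=> z; exact: measurable_itv.
apply/seteqP; split => x /=.
  by move=> [z xz]; exists z => //=; rewrite in_itv /= -ler_distl.
by move=> [z _ /=]; rewrite in_itv /= -ler_distl => xz; exists z.
Qed.

Definition tail_near n m : set R := \bigcap_(k in [set k | (m <= k)%N]) near_lattice k n.

Lemma borel_tail_near n m : borel (tail_near n m).
Proof.
apply: bigcap_measurable; first by exists m => /=.
by move=> k _; exact: borel_near_lattice.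
Qed.

Lemma approx_groupE : approx_group = \bigcap_n \bigcup_m tail_near n m.
Proof.
apply/seteqP; split => x Gx n; first by move=> _; have [m hm] := Gx n; exists m.
by have [//|m _ hm] := Gx n; exists m.
Qed.

Lemma approx_coreE t : approx_core t = \bigcap_n tail_near n (t n).
Proof.
by apply/seteqP; split => x Kx n; [move=> _ k /= | move=> k]; exact: Kx.
Qed.

Lemma borel_approx_group : borel approx_group.
Proof.
rewrite approx_groupE; apply: bigcap_measurable; first by exists 0.
by move=> n _; apply: bigcup_measurable => m _; exact: borel_tail_near.
Qed.

Lemma borel_approx_core t : borel (approx_core t).
Proof.
rewrite approx_coreE; apply: bigcap_measurable; first by exists 0.
by move=> n _; exact: borel_tail_near.
Qed.

(** The prefix of length [mesh k] is a lattice point, and a run of zeros up to [precision k + w]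
    puts the value within [2^(-w)] times [dyad R (precision k)] of it. *)
Lemma approx_group_binval (b : nat -> bool) :
  (forall w, exists k0, forall k q, (k0 <= k)%N ->
    (mesh k <= q < precision k + w)%N -> ~~ b q) ->
  0 <= alpha <= 1 ->
  approx_group (binval R b).
Proof.
move=> bF a01 n; have [k0 hk0] := bF n; exists k0 => k kk0.
have [z hz] := digit_sum_natmul R b (mesh k); exists (Posz z).
have := binval_bounds R b (precision k + n).
rewrite (@digit_sum_const _ _ (mesh k)); last first.
- by move=> q hq; apply: (hk0 k).
- by apply: leq_trans (mesh_le_precision a01 k) _; exact: leq_addr.
rewrite hz addnC => /andP[h1 h2]; rewrite ler_norml /=.
have := dyad_gt0 R (n + precision k); rewrite pmulrn in h1 h2 *.
by move: h1 h2; lra.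
Qed.

Section Separation.
Hypothesis alpha01 : 0 <= alpha <= 1.
Variable t : nat -> nat.

(** Summing the thresholds dominates each [t (i + 3)] and keeps the sequence strictly increasing;
    the term [i + 3] keeps later digits out of the window of four positions from [digit_pos i]
    on. *)
Definition scale_idx i : nat := (i + 3 + \sum_(j < i.+1) t (j + 3))%N.

(** The growing offset [i] makes the digit negligible against the precision, which puts the sums in
    the group. *)
Definition digit_pos i : nat := (precision (scale_idx i) + i)%N.

Definition selection (c : nat -> bool) : nat -> bool :=
  fun q => `[< exists i, q = digit_pos i /\ c i >].

Lemma scale_idx_ge i : (i + 3 <= scale_idx i)%N.
Proof. by rewrite /scale_idx; lia. Qed.

Lemma scale_idx_ge_t i : (t (i + 3) <= scale_idx i)%N.
Proof. by rewrite /scale_idx big_ord_recr /=; lia. Qed.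

Lemma scale_idx_lt i j : (i < j)%N -> (scale_idx i < scale_idx j)%N.
Proof.
elim: j => // j IH; rewrite ltnS leq_eqVlt => ij.
have lt : (scale_idx j < scale_idx j.+1)%N.
  by rewrite /scale_idx [in X in (_ < X)%N]big_ord_recr /=; lia.
by case/predU1P: ij => [-> //|/IH]; lia.
Qed.

Lemma digit_pos_lt k i : (scale_idx i < k)%N -> (digit_pos i < mesh k)%N.
Proof.
by move=> /(precision_lt_mesh alpha01); have := scale_idx_ge i; rewrite /digit_pos; lia.
Qed.

Lemma selection_binval c : approx_group (binval R (selection c)).
Proof.
apply: approx_group_binval => // w; exists (w + (scale_idx w).+1)%N => k q hk hq.
apply/asboolP => -[i [qE _]].
have [ik|ki|ik] := ltngtP (scale_idx i) k.
- by have := digit_pos_lt ik; lia.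
- have := precision_lt alpha01 ki; rewrite /digit_pos in qE; lia.
- have iw : (i < w)%N by move: qE hq; rewrite /digit_pos ik; lia.
  by have := scale_idx_lt iw; lia.
Qed.

(** Digits before [mesh k] only contribute lattice points and no other digit occurs before [p + 4].
    So the difference is a lattice point plus or minus [dyad R p.+1], up to an error [dyad R p.+4],
    while the tolerance is [dyad R p.+2]. *)
Lemma selection_separated c c' i : c i != c' i ->
  ~ near_lattice (scale_idx i) (i + 2)
      (binval R (selection c) - binval R (selection c')).
Proof.
move=> cc'; set k := scale_idx i => -[z].
set p := digit_pos i; set D := dyad R (mesh k).
have nkp : (mesh k <= p)%N.
  by apply: leq_trans (mesh_le_precision alpha01 k) _; rewrite /p /digit_pos leq_addr.
have empty c0 q : (mesh k <= q < p + 4)%N -> q != p -> ~~ selection c0 q.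
  move=> hq /eqP qp; apply/asboolP => -[j [qE _]].
  have [ij|ji|ij] := ltngtP i j.
  - have := precision_lt alpha01 (scale_idx_lt ij); move: qE hq.
    by rewrite /p /digit_pos -/k; have := scale_idx_ge i; rewrite -/k; lia.
  - by have := digit_pos_lt (scale_idx_lt ji); rewrite -/k; lia.
  - by apply: qp; rewrite qE -ij.
have selp c0 : selection c0 p = c0 i.
  apply/asboolP/idP => [[j [pj cj]]|ci]; last by exists i.
  have [ij|ji|-> //] := ltngtP i j.
  - have := precision_lt alpha01 (scale_idx_lt ij); move: pj.
    by rewrite /p /digit_pos -/k; have := scale_idx_ge i; rewrite -/k; lia.
  - by have := digit_pos_lt (scale_idx_lt ji); rewrite -/k; lia.
have expand (c0 : nat -> bool) : exists z0 : nat,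
    z0%:R * D + (c0 i)%:R * dyad R p.+1 <= binval R (selection c0) <=
    z0%:R * D + (c0 i)%:R * dyad R p.+1 + dyad R (p + 4).
  have [z0 hz0] := digit_sum_natmul R (selection c0) (mesh k); exists z0.
  have := binval_bounds R (selection c0) (p + 4).
  rewrite (@digit_sum_const _ _ p.+1) ?digit_sumS ?selp; last first.
  - by move=> q hq; apply: empty; lia.
  - by lia.
  rewrite (@digit_sum_const _ _ (mesh k) p) //; last first.
    by move=> q hq; apply: empty; lia.
  by rewrite hz0.
have [z1 h1] := expand c; have [z2 h2] := expand c'.
rewrite (_ : i + 2 + precision k = p.+2)%N; last by rewrite /p /digit_pos -/k; lia.
rewrite ler_norml => h3.
have D2 : 2 * dyad R p.+1 <= D by rewrite -dyadS; exact: dyad_le.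
have e1 := dyadS R p.+1; have e2 := dyadS R p.+2; have e3 := dyadS R p.+3.
have d0 := dyad_gt0 R p.+4; rewrite addn4 in h1 h2.
set Z : int := Posz z1 - Posz z2 - z.
have ZD : Z%:~R * D = z1%:R * D - z2%:R * D - z%:~R * D.
  by rewrite /Z !rmorphB /= -!pmulrn; ring.
have D0 : 0 < D := dyad_gt0 R _.
(* If [Z = 0], the digit at [p] alone exceeds the tolerance plus the error. Otherwise the lattice
   part has size at least [D >= 2 * dyad R p.+1], and the digit cancels at most half of it. *)
have : Z = 0 \/ D <= Z%:~R * D \/ Z%:~R * D <= - D.
  have [Z0|Z0|->] := ltgtP Z 0; [right; right|right; left|by left].
    rewrite -[leRHS]mulN1r ler_pM2r // -(rmorphN1 (intmul 1)) ler_int.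
    by lia.
  by rewrite ler_peMl ?(ltW D0) // ler1z.
case/andP: h1 h2 h3 => [h1 h1'] /andP[h2 h2'] /andP[h3 h3'].
case: (c i) (c' i) cc' h1 h1' h2 h2' => -[] //= _; rewrite ?mul1r ?mul0r ?addr0;
  move=> h1 h1' h2 h2' [Z0|[]];
  try (move: ZD; rewrite Z0 mul0r => ZD); lra.
Qed.

(** A common point would make the difference of the two sums a difference of two core points. Both
    are near the lattice with index [i + 3] at scale [scale_idx i], so their difference is near it
    with index [i + 2]. *)
Lemma approx_core_translates_disjoint c c' : c <> c' ->
  translate (binval R (selection c)) (approx_core t) `&`
  translate (binval R (selection c')) (approx_core t) = set0.
Proof.
move=> cc'; have [i ci] : exists i, c i != c' i.
  apply: contrapT => h; apply: cc'; apply/funext => i.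
  by apply/eqP; apply/negPn/negP => hi; apply: h; exists i.
rewrite -subset0 => _ [[x Kx <-] [y Ky /= yx]].
apply: (selection_separated ci).
rewrite (_ : _ - _ = y - x); last by lra.
have st := scale_idx_ge_t i.
by apply: near_latticeB; [apply: Ky | apply: Kx]; rewrite -addnS.
Qed.

End Separation.
End Group.

(** * Positive measure and countability *)

Section MeasureTheory.
Local Open Scope ereal_scope.

(** Cantor's diagonal: by injectivity [c (f c')] is the negation of [c' (f c')] for every [c'],
    absurd for [c' = c]. *)
Lemma uncountable_bool_seq : ~ countable [set: nat -> bool].
Proof.
move=> /countable_injP[f f_inj].
pose c n := ~~ `[< exists2 c, f c = n & c n >].
have [[c' fc' c'n]|h] := pselect (exists2 c', f c' = f c & c' (f c)).
  have c'c : c' = c by apply: f_inj fc'; rewrite inE.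
  have : c (f c) by rewrite -{1}c'c.
  by move=> /asboolPn; apply; exists c'.
have cT : c (f c) by apply/asboolPn.
by apply: h; exists c.
Qed.

Context d (T : measurableType d) (R : realType).
Variable mu : {measure set T -> \bar R}.

(** For each [n], the part of [D] outside [A n m] shrinks to the empty set, so some [t n] loses at
    most [e / 2 ^ n.+1]. With [e] half of [mu D], the total loss cannot exhaust [D]. *)
Lemma measure_uniform_threshold (D : set T) (A : nat -> nat -> set T) :
  measurable D -> 0 < mu D -> mu D < +oo ->
  (forall n m, measurable (A n m)) ->
  (forall n m m', (m <= m')%N -> A n m `<=` A n m') ->
  D `<=` \bigcap_n \bigcup_m A n m ->
  exists t : nat -> nat, 0 < mu (\bigcap_n A n (t n)).
Proof.
move=> mD D0 Doo mA Amono DA.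
have fD : mu D \is a fin_num by rewrite ge0_fin_numE.
have mDA n m : measurable (D `\` A n m) by exact: measurableD.
have DAoo n m : mu (D `\` A n m) < +oo.
  by apply: le_lt_trans Doo; apply: le_measure; rewrite ?inE //; exact: subDsetl.
set e : R := (fine (mu D) / 2)%R.
have e0 : (0 < e)%R by rewrite divr_gt0 // fine_gt0 // D0.
have /choice[t ht] : forall n, exists m,
    mu (D `\` A n m) <= (e / (2 ^ n.+1)%:R)%:E.
  move=> n.
  have B0 : \bigcap_m (D `\` A n m) = set0.
    rewrite -subset0 => x Bx; have [Dx _] := Bx 0%N I.
    by have [m _ Am] := DA x Dx n I; have [_] := Bx m I.
  have : mu (D `\` A n m) @[m --> \oo] --> mu (\bigcap_m (D `\` A n m)).
    apply: nonincreasing_cvg_mu.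
    - exact: DAoo.
    - by move=> m; exact: mDA.
    - by rewrite B0.
    - move=> m m' mm'; apply/subsetPset => x [Dx nA]; split=> // Ax.
      by apply: nA; exact: Amono Ax.
  rewrite B0 measure0 => /fine_cvgP[_ /cvgrPdist_le].
  have en : (0 < e / (2 ^ n.+1)%:R)%R by rewrite divr_gt0 // ltr0n expn_gt0.
  move=> /(_ _ en)[m _ /(_ m (leqnn m))] /=.
  rewrite sub0r normrN => h; exists m.
  have fB : mu (D `\` A n m) \is a fin_num.
    by rewrite ge0_fin_numE.
  by rewrite -(fineK fB) lee_fin; apply: le_trans h; exact: ler_norm.
exists t; rewrite lt_neqAle measure_ge0 andbT eq_sym; apply/eqP => K0.
have mK : measurable (\bigcap_n A n (t n)).
  by apply: bigcap_measurable => //; exists 0%N.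
have mUB : measurable (\bigcup_n (D `\` A n (t n))).
  by apply: bigcup_measurable => n _; exact: mDA.
have : mu D <= mu (\bigcap_n A n (t n)) + mu (\bigcup_n (D `\` A n (t n))).
  apply: le_trans (measureU2 _ _ _) => //.
  apply: le_measure; rewrite ?inE //; first exact: measurableU.
  move=> x Dx; have [|/existsNP[n nA]] := pselect (forall n, A n (t n) x).
    by move=> h; left => n _; exact: h.
  by right; exists n.
rewrite K0 add0e => h.
have : mu D <= e%:E.
  apply: le_trans h _.
  apply: le_trans (_ : \sum_(0 <= n <oo) (e / (2 ^ n.+1)%:R)%:E <= _).
    apply: le_trans (_ : \sum_(0 <= n <oo) mu (D `\` A n (t n)) <= _).
      exact: measure_sigma_subadditive.
    by apply: lee_nneseries => n _.
  by apply: (epsilon_trick0 xpredT); rewrite ltW.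
by rewrite -(fineK fD) lee_fin /e; move: e0; rewrite /e; lra.
Qed.

(** Each [A i] meets some [F k] in measure above some [1 / n.+1], and for fixed [k] and [n] only
    finitely many disjoint sets can do so. *)
Lemma countable_disjoint_pos_measure (I : choiceType) (F : nat -> set T)
    (A : I -> set T) :
  (forall k, measurable (F k)) -> (forall k, mu (F k) < +oo) ->
  (forall i, measurable (A i)) -> (forall i, A i `<=` \bigcup_k F k) ->
  (forall i, 0 < mu (A i)) ->
  (forall i j, i <> j -> A i `&` A j = set0) ->
  countable [set: I].
Proof.
move=> mF Foo mA AF A0 Adisj.
pose J k n := [set i | ((n.+1%:R)^-1)%:E < mu (A i `&` F k)].
have -> : [set: I] = \bigcup_k \bigcup_n J k n.
  apply/seteqP; split => // i _.
  have [k hk] : exists k, 0 < mu (A i `&` F k).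
    apply: contrapT => /forallNP h.
    have : mu (A i) <= 0.
      rewrite (_ : A i = \bigcup_k (A i `&` F k)); last first.
        by rewrite -setI_bigcupr; apply/esym/setIidPl; exact: AF.
      apply: le_trans (measure_sigma_subadditive _ _ _ (@subset_refl _ _)) _.
      - by move=> k; exact: measurableI.
      - by apply: bigcup_measurable => k _; exact: measurableI.
      - rewrite eseries0 // => k _ _; apply/eqP; rewrite eq_le measure_ge0 andbT.
        by rewrite leNgt; apply/negP; exact: h.
    by rewrite leNgt A0.
  exists k => //.
  have [f|] := boolP (mu (A i `&` F k) \is a fin_num).
    exists (Num.truncn (fine (mu (A i `&` F k)))^-1)%N => //=.
    rewrite /J /= -(fineK f) lte_fin -[ltRHS]invrK ltf_pV2 ?posrE ?invr_gt0 //.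
    - exact: truncnS_gt.
    - by rewrite fine_gt0 // hk ltey_eq f.
  rewrite ge0_fin_numE // -leNgt leye_eq => /eqP h.
  by exists 0%N => //; rewrite /J /= h ltry.
apply: bigcup_countable => // k _; apply: bigcup_countable => // n _.
apply: finite_set_countable; apply: contrapT => /infinite_set_fset hinf.
have fF : mu (F k) \is a fin_num by rewrite ge0_fin_numE.
(* More than [n.+1 * mu (F k)] disjoint pieces of measure above [1 / n.+1] would outweigh [F k]. *)
have [B BJ Bsize] := hinf (Num.truncn (n.+1%:R * fine (mu (F k)))%R).+1.
have : \sum_(i \in [set` B]) mu (A i `&` F k) <= mu (F k).
  rewrite -measure_fin_bigcup //; last 2 first.
  - move=> i j _ _ [x [[Ai _] [Aj _]]]; apply: contrapT => ij.
    by have := Adisj _ _ ij; rewrite -subset0 => /(_ x); apply.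
  - by move=> i _; exact: measurableI.
  apply: le_measure; rewrite ?inE //.
  - apply: fin_bigcup_measurable; first exact: finite_fset.
    by move=> i _; exact: measurableI.
  - by move=> x [i _ []].
rewrite leNgt => /negP; apply.
rewrite fsbig_finite; last exact: finite_fset.
rewrite set_fsetK //=.
have lb : \sum_(i <- finmap.enum_fset B) (n.+1%:R^-1)%:E <=
    \sum_(i <- finmap.enum_fset B) mu (A i `&` F k).
  by rewrite big_seq [leRHS]big_seq; apply: lee_sum => i iB; exact/ltW/BJ.
apply: lt_le_trans lb.
rewrite sumEFin big_const_seq count_predT iter_addr_0 -(fineK fF) lte_fin.
have : ((Num.truncn (n.+1%:R * fine (mu (F k)))%R).+1%:R <=
    (size (finmap.enum_fset B))%:R :> R)%R.
  by rewrite ler_nat.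
move=> /(lt_le_trans (truncnS_gt _)).
by move=> h; rewrite -[ltRHS]mulr_natl ltr_pdivlMr ?ltr0n // mulrC.
Qed.

End MeasureTheory.

(** * Immeasurability of the group *)

Lemma immeasurable_approx_group (R : realType) (alpha : R) :
  0 <= alpha <= 1 -> immeasurable (@approx_group R alpha).
Proof.
move=> alpha01; split; first exact: borel_approx_group.
  by exists 0; apply/set_mem; exact: (approx_group_zmod_closed alpha).1.
move=> S mu _ BS inv; set G := approx_group alpha.
have [->|G0] := eqVneq (mu G) 0%E; [by left | right => -[F GF hF]].
have mS (A : set R) : S A -> @measurable _ (g_sigma_algebraType S) A.
  by move=> SA; exact: sub_sigma_algebra.
have mF k : measurable (F k) by have [] := hF k.
have Foo k : (mu (F k) < +oo)%E by have [] := hF k.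
have [k Fk0] : exists k, (0 < mu (F k))%E.
  apply: contrapT => /forallNP h; move/eqP: G0; apply.
  apply/eqP; rewrite eq_le measure_ge0 andbT.
  have : (mu G <= \sum_(0 <= k <oo) mu (F k))%E.
    apply: measure_sigma_subadditive => //; last by rewrite GF.
    apply: mS; apply: BS; exact: borel_approx_group.
  rewrite eseries0 // => k _ _; apply/eqP; rewrite eq_le measure_ge0 andbT.
  by rewrite leNgt; apply/negP; exact: h.
have [|||t K0] := @measure_uniform_threshold _ _ _ mu (F k)
  (@tail_near R alpha) (mF k) Fk0 (Foo k).
- by move=> n m; apply: mS; apply: BS; exact: borel_tail_near.
- by move=> n m m' mm' x hx j /= m'j; apply: hx => /=; exact: leq_trans m'j.
- by rewrite -approx_groupE -/G GF; exact: bigcup_sup.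
rewrite -approx_coreE in K0.
have SK : S (approx_core alpha t) by apply: BS; exact: borel_approx_core.
(* The translates of the core are disjoint, lie in the group and share its positive measure, so the
   sigma-finite cover [F] would make their index set countable. *)
apply: uncountable_bool_seq.
apply: (@countable_disjoint_pos_measure _ _ _ mu _ F
  (fun c => translate (binval R (selection t c)) (approx_core alpha t))) => //.
- by move=> c; apply: mS; exact: (inv _ _ SK).1.
- move=> c _ [x Kx <-]; rewrite -GF; apply: approx_groupD.
    exact: approx_core_sub Kx.
  exact: selection_binval.
- by move=> c; rewrite (inv _ _ SK).2.
- by move=> c c'; exact: approx_core_translates_disjoint.
Qed.

(** * Density of free digit positions and cost of lattice covers *)

Section FreePositions.
Variables (R : realType) (alpha : R).
Hypothesis alpha01 : 0 <= alpha <= 1.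
Implicit Types (k n m N : nat) (s : R).

Local Notation mesh := (mesh alpha).

(** The [k] zeros past [precision k] make the scaled distance to the lattice at most [2^(-k)], hence
    tend to 0. *)
Definition free_pos : nat -> bool :=
  fun q => ~~ `[< exists k, (mesh k <= q < precision k + k)%N >].

Lemma free_posP k q : (precision k + k <= q < mesh k.+1)%N -> free_pos q.
Proof.
move=> hq; apply/asboolPn => -[k' hk'].
have [k'k|kk'] := leqP k' k.
  move: k'k; rewrite leq_eqVlt => /predU1P[k'k|/(precision_lt alpha01)]; last by lia.
  by subst k'; lia.
move: kk'; rewrite leq_eqVlt => /predU1P[kk'|/(precision_lt_mesh alpha01)].
  by subst k'; lia.
by have := mesh_le_precision alpha01 k.+1; lia.
Qed.

Lemma rank_free_block k N : (precision k + k <= N <= mesh k.+1)%N ->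
  rank free_pos N = (rank free_pos (precision k + k) + (N - (precision k + k)))%N.
Proof.
move=> hN; apply: rank_full; first by lia.
by move=> q hq; apply: (@free_posP k); lia.
Qed.

Lemma rank_free_unbounded r : exists N, (r <= rank free_pos N)%N.
Proof.
exists (mesh r); elim: r => // r IH.
have mmr := precision_lt_meshS alpha r.
rewrite (@rank_free_block r); last by rewrite leqnn andbT ltnW.
have : (rank free_pos (mesh r) <= rank free_pos (precision r + r))%N.
  by apply: rank_mono; have := mesh_le_precision alpha01 r; lia.
by lia.
Qed.

(** The free run before [mesh k.+1] alone has about [alpha * precision k.+1] positions, enough for
    all [N] up to the end of the next zero block. The constant [c] absorbs the [N] below the first
    block with good growth. *)
Lemma rank_free_ge s : 0 <= s -> s < alpha ->
  exists c, forall N, s * N%:R <= (rank free_pos N)%:R + c.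
Proof.
move=> s0 sa; have /andP[a0 a1] := alpha01.
have [|k0 hk0] := @precision_growth R (alpha - s); first by lra.
have block k : (k0 <= k)%N ->
    s * (precision k.+1 + k.+1)%:R <= (rank free_pos (mesh k.+1))%:R.
  move=> /hk0 hk; have := mesh_ge alpha k.+1.
  have mmk := precision_lt_meshS alpha k.
  rewrite (@rank_free_block k); last by rewrite leqnn andbT ltnW.
  rewrite !natrD (natrB _ (ltnW mmk)) -(@natr1 R k) => h.
  have sk : s * k%:R <= k%:R by apply: ler_piMl => //; lra.
  have : 0 <= (rank free_pos (precision k + k))%:R :> R by [].
  by move: hk; rewrite !natrD; lra.
set b := fun k => (precision k + k)%N.
(* Along a free run the rank grows with slope [1 >= s]; in a zero block the bound at the right end
   is the strongest. *)
have main j N : (b k0.+1 <= N <= b (k0.+1 + j))%N ->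
    s * N%:R <= (rank free_pos N)%:R.
  elim: j N => [|j IH] N.
    rewrite addn0 => hN; have -> : N = b k0.+1 by lia.
    apply: le_trans (block k0 (leqnn _)) _; rewrite ler_nat.
    by apply: rank_mono; have := mesh_le_precision alpha01 k0.+1; rewrite /b; lia.
  rewrite addnS; have bk : (b k0.+1 <= b (k0.+1 + j))%N.
    case: j {IH} => [|j]; first by rewrite addn0.
    by have := @precision_lt _ _ alpha01 k0.+1 (k0.+1 + j.+1); rewrite /b; lia.
  have kk0 : (k0 <= k0.+1 + j)%N by lia.
  move: (k0.+1 + j)%N IH bk kk0 => k IH bk kk0 hN.
  have [Nb|bN] := leqP N (b k); first by apply: IH; lia.
  have [Nn|nN] := leqP N (mesh k.+1).
    rewrite (@rank_free_block k) -/(b k); last by rewrite Nn -/(b k) ltnW.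
    have : s * (b k)%:R <= (rank free_pos (b k))%:R.
      by apply: IH; rewrite leqnn andbT; lia.
    rewrite natrD (natrB _ (ltnW bN)).
    have : 0 <= N%:R - (b k)%:R :> R by rewrite subr_ge0 ler_nat ltnW.
    move: (N%:R) ((b k)%:R) ((rank free_pos (b k))%:R) => x y z xy h.
    by nra.
  apply: le_trans (_ : s * (b k.+1)%:R <= _).
    by rewrite ler_wpM2l // ler_nat; lia.
  apply: le_trans (block k kk0) _.
  by rewrite ler_nat; apply: rank_mono; exact: ltnW.
exists (s * (b k0.+1)%:R) => N.
have [bN|Nb] := leqP (b k0.+1) N.
  have : s * N%:R <= (rank free_pos N)%:R.
    by apply: (main N); rewrite bN /b /=; lia.
  have : 0 <= s * (b k0.+1)%:R by rewrite mulr_ge0.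
  by lra.
apply: le_trans (_ : s * (b k0.+1)%:R <= _).
  by rewrite ler_wpM2l // ler_nat ltnW.
by rewrite lerDr.
Qed.

Lemma spread_free_in_group (y : R) : approx_group alpha (binval R (spread free_pos y)).
Proof.
apply: approx_group_binval => // w; exists w => k q wk hq.
rewrite /spread negb_and; apply/orP; left; rewrite negbK.
by apply/asboolP; exists k; lia.
Qed.

(** The midpoint [s'] satisfies [mesh k <= s' * precision k] eventually, and the margin
    [(s - s') * precision k] in the exponent outgrows all remaining terms. *)
Lemma lattice_cover_small s (e : R) : alpha < s -> 0 < e ->
  exists k0, forall k, (k0 <= k)%N ->
    (2 * (k.+1 * 2 ^ mesh k) + 1)%:R * (2 * dyad R (precision k)) `^ s <= e.
Proof.
move=> sa e0; have /andP[a0 a1] := alpha01.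
set s' := (alpha + s) / 2.
have [|k1 hk1] := mesh_le_eventually alpha01 (s := s'); first by rewrite /s'; lra.
have [|k2 hk2] := @precision_growth R (s - s'); first by rewrite /s'; lra.
have [|n hn] := @dyad_lt_eps R (e / 2 `^ s); first by rewrite divr_gt0 // powR_gt0.
exists (k1 + k2 + n).+1 => -[//|k] hk.
have /hk1 h1 : (k1 <= k.+1)%N by lia.
have /hk2 h2 : (k2 <= k)%N by lia.
have d0 := dyad_gt0 R.
rewrite powRM //; last exact: ltW.
have two0 : 2 != 0 :> R by [].
have pos2 : 0 < 2 `^ s :> R by rewrite powR_gt0.
apply: (@le_trans _ _ (2 `^ s * dyad R n)); last first.
  by rewrite mulrC -ler_pdivlMr // ltW.
rewrite mulrCA ler_pM2l //.
(* Here [k.+2 < 2 ^ k.+2] turns the count into a power of two. *)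
have J : (2 * (k.+2 * 2 ^ mesh k.+1) + 1)%:R <=
    2 `^ ((k.+4)%:R + s' * (precision k.+1)%:R) :> R.
  apply: (@le_trans _ _ (2 ^+ (k.+4 + mesh k.+1))).
    rewrite -natrX ler_nat expnD 2!expnS.
    have v0 := ltn_expl k.+2 (isT : (1 < 2)%N).
    have u0 : (0 < 2 ^ mesh k.+1)%N by rewrite expn_gt0.
    have := leq_mul v0 (leqnn (2 ^ mesh k.+1)).
    by move: (2 ^ mesh k.+1)%N (2 ^ k.+2)%N u0 {v0} => u v; lia.
  by rewrite -powR_mulrn // ler_powR ?ler1n // natrD lerD2l.
apply: le_trans (ler_wpM2r (powR_ge0 _ _) J) _.
rewrite !dyad_powR -powRrM -powRD ?(negbTE two0) ?implybT //.
rewrite ler_powR ?ler1n //.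
move: h2; rewrite !natrD -(@natr1 R k.+3)
  -(@natr1 R k.+2) -(@natr1 R k.+1) -(@natr1 R k).
have : n%:R <= k%:R :> R by rewrite ler_nat; lia.
have : 0 <= (precision k)%:R :> R by [].
by lra.
Qed.

End FreePositions.

(** * Criteria for zero and nonzero Hausdorff measure *)

Section Hausdorff.
Variable R : realType.
Implicit Types (A U : set R) (s delta e : R).

Lemma diam_ge0 U : U !=set0 -> (0 <= diam U)%E.
Proof.
move=> [x Ux]; apply: ereal_sup_ubound; exists x => //; exists x => //.
by rewrite subrr normr0.
Qed.

Lemma le_diam U x y : U x -> U y -> (`|x - y|%:E <= diam U)%E.
Proof. by move=> Ux Uy; apply: ereal_sup_ubound; exists x => //; exists y. Qed.

Lemma diam_le U (d : R) : (forall x y, U x -> U y -> `|x - y| <= d) ->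
  (diam U <= d%:E)%E.
Proof.
move=> h; apply: ge_ereal_sup => _ [x Ux [y Uy <-]].
by rewrite lee_fin h.
Qed.

Lemma hausdorff_gauge_ge0 s U : (0 <= hausdorff_gauge s U)%E.
Proof. by rewrite /hausdorff_gauge; case: ifP => // _; exact: poweR_ge0. Qed.

Lemma hausdorff_gauge_set0 s : hausdorff_gauge s (set0 : set R) = 0%E.
Proof. by rewrite /hausdorff_gauge eqxx. Qed.

Lemma hausdorff_gauge_ge s U (d : R) x y : 0 <= s -> (diam U <= d%:E)%E ->
  U x -> U y -> ((`|x - y| `^ s)%:E <= hausdorff_gauge s U)%E.
Proof.
move=> s0 Ud Ux Uy; rewrite /hausdorff_gauge ifF; last first.
  by apply/negbTE/set0P; exists x.
have dU := le_diam Ux Uy.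
have D0 : (0 <= diam U)%E by apply: diam_ge0; exists x.
have fU : diam U \is a fin_num by rewrite ge0_fin_numE // (le_lt_trans Ud) // ltry.
move: dU D0; rewrite -(fineK fU) poweR_EFin !lee_fin => dU D0.
by apply: ge0_ler_powR.
Qed.

Lemma hausdorff_gauge_le s U (d : R) : 0 <= s -> 0 <= d ->
  (forall x y, U x -> U y -> `|x - y| <= d) ->
  (hausdorff_gauge s U <= (d `^ s)%:E)%E.
Proof.
move=> s0 d0 /diam_le Ud; rewrite /hausdorff_gauge.
case: ifPn => [_|/set0P U0]; first by rewrite lee_fin powR_ge0.
have D0 := diam_ge0 U0.
have fU : diam U \is a fin_num by rewrite ge0_fin_numE // (le_lt_trans Ud) // ltry.
move: Ud D0; rewrite -(fineK fU) poweR_EFin !lee_fin => Ud D0.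
by apply: ge0_ler_powR.
Qed.

Lemma nneseries_pair (a : nat * nat -> \bar R) (f : nat -> nat * nat) :
  bijective f -> (forall p, 0 <= a p)%E ->
  (\sum_(0 <= i <oo) a (f i) = \sum_(0 <= k <oo) \sum_(0 <= j <oo) a (k, j))%E.
Proof.
move=> [g fK gK] a0; rewrite nneseries_esumT //.
transitivity (\esum_(k in [set: nat]) \esum_(j in [set: nat]) a (k, j))%E.
  rewrite esum_esum //= (_ : _ `*`` _ = [set: nat * nat]); last first.
    by apply/seteqP; split=> // -[].
  rewrite (reindex_esum [set: nat] [set: nat * nat] f) //=; last first.
    by rewrite setTT_bijective; exists g.
  by apply: eq_esum => i _; rewrite -surjective_pairing.
rewrite nneseries_esumT; last by move=> k; exact: nneseries_ge0.
by apply: eq_esum => k _; rewrite nneseries_esumT.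
Qed.

(** Covers indexed by scale and lattice point become sequences through a bijection between [nat] and
    [nat * nat]. *)
Lemma hausdorff_measure_eq0 s A :
  (forall delta e, 0 < delta -> 0 < e ->
    exists U : nat -> nat -> set R,
    [/\ A `<=` \bigcup_k \bigcup_j U k j,
        forall k j, (diam (U k j) <= delta%:E)%E &
        (\sum_(0 <= k <oo) \sum_(0 <= j <oo) hausdorff_gauge s (U k j) <= e%:E)%E]) ->
  hausdorff_measure s A = 0%E.
Proof.
move=> HU; have pre0 delta : (0 <= hausdorff_premeasure s delta A)%E.
  apply: le_ereal_inf_tmp => _ [U _ <-].
  by apply: nneseries_ge0 => n _ _; exact: hausdorff_gauge_ge0.
apply/eqP; rewrite eq_le; apply/andP; split; last first.
  by apply: le_trans (pre0 1) _; apply: ereal_sup_ubound; exists 1 => //=.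
apply: ge_ereal_sup => _ [delta /= delta0 <-]; apply/lee_addgt0Pr => e e0.
rewrite add0e; have [U [AU dU Ue]] := HU _ _ delta0 e0.
have /card_esym/ppcard_eqP[f] := card_nat2.
have fbij : bijective f by rewrite -setTT_bijective; exact: bij.
have [h fK hK] := fbij.
apply: le_trans Ue.
rewrite -(@nneseries_pair (fun p => hausdorff_gauge s (U p.1 p.2)) f) //; last first.
  by move=> p; exact: hausdorff_gauge_ge0.
apply: ereal_inf_lbound; exists (fun i => U (f i).1 (f i).2) => //; split=> [x|i] //.
by move=> /AU[k _ [j _ Ux]]; exists (h (k, j)) => //; rewrite hK.
Qed.

(* A map of [0, 1) into [A] whose inverse is Hoelder of exponent [s] turns a
   cover of [A] into a cover of [0, 1) by intervals of total length at most
   [2 * C] times the sum of the gauges. *)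
Lemma hausdorff_measure_neq0 s A (C : R) (g : R -> R) : 0 <= s -> 0 < C ->
  (forall y : R, 0 <= y < 1 -> A (g y)) ->
  (forall y y' : R, 0 <= y -> y' < 1 -> y < y' -> y' - y <= C * `|g y' - g y| `^ s) ->
  hausdorff_measure s A != 0%E.
Proof.
move=> s0 C0 gA Hg; apply/eqP => H0.
(* Total gauge below [(4 * C)^-1] yields intervals of total length at most 1/2, too short to cover
   [0, 1). *)
have e0 : 0 < (4 * C)^-1 by rewrite invr_gt0; lra.
have : (hausdorff_premeasure s 1 A < ((4 * C)^-1)%:E)%E.
  apply: le_lt_trans (_ : (0 < _)%E); last by rewrite lte_fin.
  by rewrite -H0; apply: ereal_sup_ubound; exists 1 => //=.
move=> /ereal_inf_lt[_ [U [AU dU] <-]] Ue.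
have fU n : hausdorff_gauge s (U n) \is a fin_num.
  rewrite /hausdorff_gauge; case: ifPn => // /set0P U0.
  have fU : diam (U n) \is a fin_num.
    by rewrite ge0_fin_numE ?diam_ge0 // (le_lt_trans (dU n)) // ltry.
  by rewrite -(fineK fU) poweR_EFin.
set c := fun n => fine (hausdorff_gauge s (U n)).
have c0 n : 0 <= c n by rewrite fine_ge0 // hausdorff_gauge_ge0.
have Hg' y y' : 0 <= y < 1 -> 0 <= y' < 1 -> forall n, U n (g y) -> U n (g y') ->
    `|y - y'| <= C * c n.
  move=> /andP[y0 y1] /andP[y'0 y'1] n Uy Uy'.
  have gle : `|g y - g y'| `^ s <= c n.
    by rewrite -lee_fin /c fineK //; apply: hausdorff_gauge_ge (dU n) _ _.
  have [yy'|yy'|->] := ltgtP y y'.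
  - rewrite distrC gtr0_norm ?subr_gt0 //; apply: le_trans (Hg _ _ y0 y'1 yy') _.
    by rewrite ler_pM2l // distrC.
  - rewrite gtr0_norm ?subr_gt0 //; apply: le_trans (Hg _ _ y'0 y1 yy') _.
    by rewrite ler_pM2l.
  - by rewrite subrr normr0 mulr_ge0 // ltW.
(* The points sent into [U n] lie within [C * c n] of any one of them; an empty interval serves if
   there are none. *)
have /choice[V HV] : forall n, exists V : interval R,
    (lebesgue_measure [set` V] <= (2 * C * c n)%:E)%E /\
    (forall y, 0 <= y < 1 -> U n (g y) -> y \in V).
  move=> n; have [[y0 [hy0 Uy0]]|nex] := pselect (exists y, 0 <= y < 1 /\ U n (g y)).
    exists `[y0 - C * c n, y0 + C * c n]; split.
      rewrite lebesgue_measure_itv /=; case: ifP => _; last first.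
        by rewrite lee_fin mulr_ge0 // mulr_ge0 // ltW.
      by rewrite -EFinB lee_fin; lra.
    move=> y hy Uy; rewrite in_itv /= -ler_distl; exact: Hg'.
  exists `]0, 0[; split.
    by rewrite set_itv_ge ?bnd_simp ?ltxx // measure0 lee_fin mulr_ge0 // mulr_ge0 // ltW.
  by move=> y hy Uy; case: nex; exists y.
have : (lebesgue_measure [set` `[0%R, (1 : R)%R[] <=
    \sum_(0 <= n <oo) lebesgue_measure ([set` V n] : set R))%E.
  apply: measure_sigma_subadditive.
  - by move=> n; exact: measurable_itv.
  - exact: measurable_itv.
  - move=> y /=; rewrite in_itv /= => hy.
    have [n _ Un] := AU _ (gA y hy).
    by exists n => //=; exact: (HV n).2.
rewrite lebesgue_measure_itv /= lte_fin ltr01 oppr0 addr0 leNgt => /negP; apply.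
apply: le_lt_trans (_ : (\sum_(0 <= n <oo) ((2 * C)%:E * hausdorff_gauge s (U n)) < _)%E).
  apply: lee_nneseries => // n _.
  by apply: le_trans (HV n).1 _; rewrite EFinM /c fineK.
rewrite nneseriesZl; last by move=> n _; exact: hausdorff_gauge_ge0.
apply: le_lt_trans (_ : ((2 * C)%:E * ((4 * C)^-1)%:E < _)%E).
  by apply: lee_wpmul2l; [rewrite lee_fin mulr_ge0 // ltW | exact: ltW].
rewrite -EFinM lte_fin invfM mulrACA divff ?gt_eqF //; lra.
Qed.

End Hausdorff.

(** * Hausdorff dimension of the group *)

Section Dimension.
Variables (R : realType) (alpha : R).
Hypothesis alpha01 : 0 <= alpha <= 1.
Local Notation mesh := (mesh alpha).

(** The number of lattice points in [-(K + 1), K + 1]; the extra unit makes room for a lattice point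
    close to a point of [-K, K]. *)
Definition lattice_count K : nat := (2 * (K.+1 * 2 ^ mesh K) + 1)%N.

Definition lattice_interval K j : set R :=
  if (j < lattice_count K)%N then
    [set x | `|x - (Posz j - Posz (K.+1 * 2 ^ mesh K)%N)%:~R * dyad R (mesh K)| <=
              dyad R (precision K)]
  else set0.

Lemma lattice_interval_diam K j x y : lattice_interval K j x ->
  lattice_interval K j y -> `|x - y| <= 2 * dyad R (precision K).
Proof.
rewrite /lattice_interval; case: ifP => // _ /=.
set c := _ * _ => hx hy; rewrite (_ : x - y = (x - c) - (y - c)); last by ring.
by apply: le_trans (ler_normB _ _) _; lra.
Qed.

Lemma lattice_interval_gauge s K : 0 <= s ->
  (\sum_(0 <= j <oo) hausdorff_gauge s (lattice_interval K j) <=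
   ((lattice_count K)%:R * (2 * dyad R (precision K)) `^ s)%:E)%E.
Proof.
move=> s0; rewrite (nneseries_split 0 (lattice_count K)); last first.
  by move=> j _; exact: hausdorff_gauge_ge0.
rewrite add0n [X in (_ + X)%E]eseries0 ?adde0; last first.
  by move=> j hj _; rewrite /lattice_interval ltnNge hj hausdorff_gauge_set0.
apply: (@le_trans _ _ (\sum_(0 <= j < lattice_count K)
    ((2 * dyad R (precision K)) `^ s)%:E)%E).
  apply: lee_sum => j _; apply: hausdorff_gauge_le => //.
    by rewrite mulr_ge0 // ltW // dyad_gt0.
  by move=> x y; exact: lattice_interval_diam.
by rewrite sumEFin sumr_const_nat subn0 lee_fin [leRHS]mulr_natl.
Qed.

Lemma mem_lattice_interval K x : `|x| <= K%:R -> near_lattice alpha K 0 x ->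
  exists j, lattice_interval K j x.
Proof.
move=> xK [z xz]; rewrite add0n in xz.
set off := (K.+1 * 2 ^ mesh K)%N.
have D0 := dyad_gt0 R (mesh K).
have zoff : `|z| <= Posz off.
  have : (`|z|%:~R : R) * dyad R (mesh K) <= K.+1%:R.
    rewrite intr_norm -(gtr0_norm D0) -normrM -natr1.
    set u := z%:~R * _ in xz *.
    rewrite (_ : u = x - (x - u)); last by ring.
    apply: le_trans (ler_normB _ _) _; apply: lerD => //.
    by apply: le_trans xz _; rewrite -(dyad0 R) dyad_le.
  rewrite dyadE ler_pdivrMr ?exprn_gt0 // -natrX -natrM.
  by rewrite pmulrn ler_int.
exists (absz (z + Posz off)); rewrite /lattice_interval -/off ifT; last first.
  by rewrite /lattice_count -/off; lia.
by rewrite /= (_ : _ - _ = z) //; lia.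
Qed.

(** One scale [K] only catches the points of [-K, K] near its lattice. Scales [kappa k >= k], each
    of cost at most [e / 2 ^ k.+1], together catch every point of the group. *)
Lemma approx_group_null s : alpha < s ->
  hausdorff_measure s (@approx_group R alpha) = 0%E.
Proof.
move=> sa; have /andP[a0 a1] := alpha01; have s0 : 0 <= s by lra.
apply: hausdorff_measure_eq0 => delta e delta0 e0.
have /choice[kappa hk] : forall k, exists K, [/\ (k <= K)%N,
    (lattice_count K)%:R * (2 * dyad R (precision K)) `^ s <= e / (2 ^ k.+1)%:R &
    2 * dyad R (precision K) <= delta].
  move=> k; have ek : 0 < e / (2 ^ k.+1)%:R by rewrite divr_gt0 // ltr0n expn_gt0.
  have [k0 hk0] := lattice_cover_small alpha01 sa ek.
  have [|n hn] := @dyad_lt_eps R (delta / 2); first by rewrite divr_gt0.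
  exists (k + k0 + n)%N; split; [by lia| by apply: hk0; lia|].
  have : dyad R (precision (k + k0 + n)) <= dyad R n.
    by apply: dyad_le; have := precision_gt (k + k0 + n); lia.
  by lra.
exists (fun k => lattice_interval (kappa k)); split.
- move=> x Gx; have [m hm] := Gx 0%N.
  set k := (m + (Num.truncn `|x|).+1)%N.
  have [kK _ _] := hk k.
  have [||j hj] := @mem_lattice_interval (kappa k) x.
  + apply/ltW/(lt_le_trans (truncnS_gt _)); rewrite ler_nat.
    by apply: leq_trans kK; rewrite /k leq_addl.
  + by apply: hm; apply: leq_trans kK; rewrite /k leq_addr.
  + by exists k => //; exists j.
- move=> k j; apply: diam_le => x y Ux Uy; have [_ _] := hk k.
  by apply: le_trans; exact: lattice_interval_diam Ux Uy.
- apply: le_trans (epsilon_trick0 xpredT (ltW e0)).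
  apply: lee_nneseries => [k _ _|k _].
    by apply: nneseries_ge0 => j _ _; exact: hausdorff_gauge_ge0.
  have [_ h _] := hk k.
  by apply: le_trans (lattice_interval_gauge _ s0) _; rewrite lee_fin.
Qed.

Lemma approx_group_not_null s : 0 <= s -> s < alpha ->
  hausdorff_measure s (@approx_group R alpha) != 0%E.
Proof.
move=> s0 sa; have [c hc] := rank_free_ge alpha01 s0 sa.
apply: (@hausdorff_measure_neq0 R s _ (2 * 2 `^ (c + s))
  (fun y => binval R (spread (free_pos alpha) y))) => //.
- by move=> y _; exact: spread_free_in_group.
- move=> y y' y0 y'1 yy'; apply: spread_inverse_holder => //.
  exact: rank_free_unbounded.
Qed.

Lemma hausdorff_dim_approx_group :
  hausdorff_dim (@approx_group R alpha) = alpha%:E.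
Proof.
have /andP[a0 a1] := alpha01; apply/eqP; rewrite eq_le; apply/andP; split.
  apply/lee_addgt0Pr => e e0; apply: ereal_inf_lbound; exists (alpha + e) => //=.
  by split; [lra | apply: approx_group_null; lra].
apply: le_ereal_inf_tmp => _ [s /= [s0 Hs] <-]; rewrite lee_fin leNgt.
by apply/negP => /(approx_group_not_null s0); rewrite Hs eqxx.
Qed.

End Dimension.

Theorem theorem3p2 (R : realType) (alpha : R) (halpha : 0 <= alpha <= 1) :
  exists B : set R,
    [/\ immeasurable B, hausdorff_dim B = alpha%:E & zmod_closed [in B]].
Proof.
exists (approx_group alpha); split.
- exact: immeasurable_approx_group.
- exact: hausdorff_dim_approx_group.
- exact: approx_group_zmod_closed.
Qed.
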